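(* Let $\mathfrak{S}=\{(1,b_1),\dots,(1,b_m)\}$ be a finite set of vectors with $b_1,\dots,b_m\in\mathbb{Z}$, and for $n\ge 0$ let $B_n$ be the number of bridges of size $n$ with steps in $\mathfrak{S}$. For all prime numbers $p$ and all non-negative integers $k$ and $s$, we have $$B_{kp^{s+1}}\equiv B_{kp^s}\mod p^{s+1}.$$
   Context: An $\mathfrak{S}$-walk of size $n$ is a sequence $(v_1,\dots,v_n)$ with each $v_j\in\mathfrak{S}$. Its geometric realization is the sequence of points $(P_0,P_1,\dots,P_n)$ with $P_0=(0,0)$ and $P_j=P_{j-1}+v_j$. A bridge is an $\mathfrak{S}$-walk whose end-point $P_n$ lies on the $x$-axis. The empty walk (size $0$) is a bridge, so $B_0=1$. *)

(* Defs.v *)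
From HB Require Import structures.
From mathcomp Require Import all_boot all_order all_algebra finmap.

Set Implicit Arguments.
Unset Strict Implicit.
Unset Printing Implicit Defensive.

Import GRing.Theory.
Local Open Scope ring_scope.

(* The step set S coerces to the finite type of its elements, so a walk of
   size n, i.e. a sequence of n steps of S, is an element of n.-tuple S. *)

(* The points P_0 = (0, 0) and P_j = P_(j-1) + v_j. *)
Definition realization (S : {fset int * int}) (n : nat) (w : n.-tuple S) :
    seq (int * int) :=
  0 :: scanl +%R 0 [seq val v | v <- w].

Definition endpoint (S : {fset int * int}) (n : nat) (w : n.-tuple S) :
    int * int :=
  last 0 (realization w).

Definition bridge (S : {fset int * int}) (n : nat) (w : n.-tuple S) : bool :=
  (endpoint w).2 == 0.

Definition nb_bridges (S : {fset int * int}) (n : nat) : nat :=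
  #|[set w : n.-tuple S | bridge w]|.

(* Main.v *)
Require Import Defs.
From HB Require Import structures.
From mathcomp Require Import all_boot all_order all_algebra finmap.

(** Cut a walk of size [k * p ^ s.+1] into [p ^ s.+1] blocks of [k] steps and
    let the cyclic group of order [p ^ s.+1] act by rotating the blocks.  The
    final height is the sum of the heights of the steps, so rotations preserve
    bridges.  The size of an orbit divides [p ^ s.+1]; hence either it is
    [p ^ s.+1], and the orbit contributes nothing to the count modulo
    [p ^ s.+1], or it divides [p ^ s], and the walk is fixed by the rotation by
    [k * p ^ s] steps ([card_fixed_modX]).  A walk of the latter kind is the
    [p]-fold repetition of a unique walk [u] of size [k * p ^ s]
    ([rot_fixed_repeat]); its final height is [p] times that of [u], so it is a
    bridge exactly when [u] is one.  There are thus [nb_bridges S (k * p ^ s)]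
    such bridges ([card_rot_fixed_bridges]). *)

Set Implicit Arguments.
Unset Strict Implicit.
Unset Printing Implicit Defensive.

Import GRing.Theory Num.Theory.

Lemma order_dvdn (T : finType) (f : T -> T) (x : T) (n : nat) :
  injective f -> iter n f x = x -> order f x %| n.
Proof.
move=> f_inj fnx; set d := order f x.
have iter_mul q : iter (q * d) f x = x.
  by elim: q => [|q IHq] //; rewrite mulSn iterD IHq iter_order.
have lt_r : n %% d < d by rewrite ltn_mod order_gt0.
have fr : iter (n %% d) f x = x.
  by rewrite -{2}fnx {2}(divn_eq n d) addnC iterD iter_mul.
by rewrite /dvdn -(findex_iter lt_r) fr findex0.
Qed.

(** A divisor of [p ^ s.+1] that does not divide [p ^ s] is [p ^ s.+1] itself,
    so every orbit of points not fixed by the [p ^ s]-th iterate is full. *)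
Lemma card_fixed_modX (T : finType) (f : T -> T) (A : {set T}) (p s : nat) :
  prime p -> injective f -> (forall x, (f x \in A) = (x \in A)) ->
  (forall x, iter (p ^ s.+1) f x = x) ->
  #|A| = #|[set x in A | iter (p ^ s) f x == x]| %[mod p ^ s.+1].
Proof.
move=> p_pr f_inj fA f_per.
set F := [set x | iter (p ^ s) f x == x].
have -> : [set x in A | iter (p ^ s) f x == x] = A :&: F.
  by apply/setP=> x; rewrite !inE.
rewrite -(cardsID F A) -modnDmr.
suff /eqP -> : p ^ s.+1 %| #|A :\: F| by rewrite addn0.
have full : A :\: F \subset order_set f (p ^ s.+1).
  apply/subsetP=> x; rewrite !inE => /andP[xF _].
  have /(dvdn_pfactor _ _ p_pr)[e le_e De] := order_dvdn f_inj (f_per x).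
  move: le_e; rewrite leq_eqVlt => /predU1P[<-|]; first by rewrite De.
  rewrite ltnS => le_e; case/negP: xF; apply/eqP.
  rewrite -(subnK le_e) expnD -De.
  by elim: (p ^ _) => // q IHq; rewrite mulSn iterD IHq iter_order.
have closed_nonfixed : fclosed f (mem (A :\: F)).
  move=> x _ /eqP <-; rewrite !inE fA -iterSr iterS.
  by rewrite (inj_eq f_inj).
by rewrite -(fcard_order_set f_inj full closed_nonfixed) dvdn_mull.
Qed.

Lemma iter_rot (T : Type) (k q : nat) (w : seq T) :
  q * k <= size w -> iter q (rot k) w = rot (q * k) w.
Proof.
elim: q => [|q IHq] le_qk; first by rewrite rot0.
have le_q : q * k <= size w.
  by rewrite (leq_trans _ le_qk) // leq_mul2r leqnSn orbT.
by rewrite iterS IHq // mulSn rotD // -mulSn.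
Qed.

(** Two words that commute, one of them [q] times as long as the other: peel
    off one copy of the short word at a time. *)
Lemma commuting_cat_repeat (T : Type) (q : nat) (u v : seq T) :
  v ++ u = u ++ v -> size v = q * size u -> v = flatten (nseq q u).
Proof.
elim: q v => [|q IHq] v uv; first by move/size0nil.
move=> sz_v; have le_uv : size u <= size v by rewrite sz_v mulSn leq_addr.
have Dv : v = u ++ drop (size u) v.
  rewrite -{1}(cat_take_drop (size u) v); congr (_ ++ _).
  by rewrite -(takel_cat u le_uv) uv take_size_cat.
rewrite [LHS]Dv /=; congr (_ ++ _); apply: IHq.
  move: uv; rewrite {1}Dv -catA => /(congr1 (drop (size u))).
  by rewrite !drop_size_cat // => ->.
by rewrite size_drop sz_v mulSn addKn.
Qed.

(** Being fixed by [rot m] means that the prefix of length [m] commutes with the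
    rest of the word. *)
Lemma rot_fixed_repeat (T : Type) (p m : nat) (w : seq T) :
  0 < p -> size w = p * m -> rot m w = w -> w = flatten (nseq p (take m w)).
Proof.
case: p => // p _ sz_w rw.
have sz_u : size (take m w) = m by rewrite size_takel // sz_w mulSn leq_addr.
rewrite -{1}(cat_take_drop m w) /=; congr (_ ++ _).
apply: commuting_cat_repeat; first by rewrite cat_take_drop.
by rewrite sz_u size_drop sz_w mulSn addKn.
Qed.

Lemma size_repeat (T : Type) (q : nat) (u : seq T) :
  size (flatten (nseq q u)) = q * size u.
Proof. by elim: q => //= q IHq; rewrite size_cat IHq. Qed.

Lemma rot_repeat (T : Type) (q : nat) (u : seq T) :
  rot (size u) (flatten (nseq q u)) = flatten (nseq q u).
Proof.
case: q => [|q] /=; first by rewrite /rot.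
by rewrite rot_size_cat; elim: q => [|q IHq] /=; rewrite ?cats0 // -catA IHq.
Qed.

Definition height (S : {fset int * int}) (w : seq S) : int :=
  (\sum_(v <- w) (val v).2)%R.

Lemma bridgeE (S : {fset int * int}) (n : nat) (w : n.-tuple S) :
  bridge w = (height w == 0%R).
Proof.
suff last_sum (a : int * int) (t : seq S) :
    (last a (scanl +%R a [seq val v | v <- t])).2 = (a.2 + height t)%R.
  by rewrite /bridge /endpoint /realization /= last_sum add0r.
elim: t a => [|v t IHt] a /=; first by rewrite /height big_nil addr0.
by rewrite IHt /height big_cons addrA.
Qed.

Lemma height_rot (S : {fset int * int}) (k : nat) (w : seq S) :
  height (rot k w) = height w.
Proof. by apply: perm_big; rewrite perm_rot. Qed.

Lemma height_repeat (S : {fset int * int}) (q : nat) (u : seq S) :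
  height (flatten (nseq q u)) = (height u *+ q)%R.
Proof.
elim: q => [|q IHq] /=; first by rewrite /height big_nil.
by rewrite {1}/height big_cat -!/(height _) IHq mulrS.
Qed.

(** Repeating [p] times is a bijection from the words of length [m] to the words
    of length [p * m] fixed by [rot m]; it multiplies the height by [p], which
    is nonzero, so it preserves and reflects bridges. *)
Lemma card_rot_fixed_bridges (S : {fset int * int}) (p m n : nat) :
  0 < p -> n = p * m ->
  #|[set w : n.-tuple S | bridge w & rot m w == w]| = nb_bridges S m.
Proof.
move=> p_gt0 Dn; rewrite /nb_bridges.
have sz (u : m.-tuple S) : size (flatten (nseq p (u : seq S))) == n.
  by rewrite size_repeat size_tuple Dn.
pose power u := Tuple (sz u).
have power_inj : injective power.
  move=> u v /(congr1 (take m \o val)); rewrite /power /=.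
  case: {sz power} p p_gt0 Dn => //= p _ _.
  by rewrite !take_size_cat ?size_tuple // => /val_inj.
rewrite -(card_imset _ power_inj); apply: eq_card => w; rewrite inE.
apply/andP/imsetP => [[bw /eqP rw]|[u]].
- have Dw := rot_fixed_repeat p_gt0 (etrans (size_tuple w) Dn) rw.
  have sz_u : size (take m w) == m.
    by rewrite size_takel // size_tuple Dn leq_pmull.
  exists (Tuple sz_u); last exact: val_inj.
  move: bw; rewrite inE !bridgeE {1}Dw height_repeat.
  by rewrite mulrn_eq0 eqn0Ngt p_gt0.
rewrite inE !bridgeE => /eqP bu ->; split.
  by rewrite /= height_repeat bu mul0rn.
by rewrite /= -{1}(size_tuple u) rot_repeat.
Qed.

Theorem proposition1 (S : {fset int * int})
    (hS : forall v : int * int, v \in S -> v.1 = 1%R)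
    (p k s : nat) (hp : prime p) :
  nb_bridges S (k * p ^ s.+1) = nb_bridges S (k * p ^ s) %[mod p ^ s.+1].
Proof.
set n := k * p ^ s.+1.
have Dn : n = p * (k * p ^ s) by rewrite /n expnS mulnCA.
pose turn (w : n.-tuple S) := [tuple of rot k w].
have turn_inj : injective turn.
  by move=> v w /(congr1 val) /= /rot_inj /val_inj.
have iter_turn q w : q * k <= n -> val (iter q turn w) = rot (q * k) w.
  move=> le_qk; rewrite -iter_rot ?size_tuple //.
  by elim: q {le_qk} => //= q ->.
have := @card_fixed_modX _ turn [set w | bridge w] p s hp turn_inj.
rewrite -(card_rot_fixed_bridges S (prime_gt0 hp) Dn) => ->.
- congr (_ %% _); apply: eq_card => w; rewrite !inE -val_eqE /= iter_turn.
    by rewrite mulnC.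
  by rewrite mulnC Dn leq_pmull ?prime_gt0.
- by move=> w; rewrite !inE !bridgeE height_rot.
move=> w; apply: val_inj; rewrite iter_turn mulnC //.
by rewrite -/n -{1}(size_tuple w) rot_size.
Qed.
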